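(* Let $T$ be a complete $\mathrm{NTP}_2$ theory. Let $p(x)$ be a co-simple partial type over a small set $A$ and assume that $p$ is stably embedded. Then $p(x)$ is simple.
   Context: We work in a monster model $\mathbb{M}$ of $T$; $p(\mathbb{M})$ is the set of realizations of $p$. A formula $\phi(x,y)$ has $\mathrm{TP}_2$ if there is an array $(a_{\alpha,i})_{\alpha,i<\omega}$ such that $\{\phi(x,a_{\alpha,i})\}_{i<\omega}$ is $2$-inconsistent for every $\alpha$ and $\{\phi(x,a_{\alpha,f(\alpha)})\}_{\alpha<\omega}$ is consistent for every $f:\omega\to\omega$; $T$ is $\mathrm{NTP}_2$ if no formula has $\mathrm{TP}_2$. A partial type $p(x)$ over $A$ is stably embedded if for any formula $\phi(\bar x,c)$ with parameters $c\in\mathbb{M}$, where $\bar x$ is an $n$-tuple of variables of the sort of $x$, there are $\psi(\bar x,y)\in L(A)$ and a tuple $d$ of realizations of $p$ such that $p(\mathbb{M})^n\cap\phi(\bar x,c)=p(\mathbb{M})^n\cap\psi(\bar x,d)$ (identifying formulas with the sets they define). A partial type $p(x)$ over $A$ is simple if there are no formula $\phi(x,y)$, tree $(a_\eta)_{\eta\in\omega^{<\omega}}$ and $k<\omega$ such that $\{\phi(x,a_{\eta\frown i})\}_{i<\omega}$ is $k$-inconsistent for every $\eta\in\omega^{<\omega}$ and $\{\phi(x,a_{\eta|i})\}_{i<\omega}\cup p(x)$ is consistent for every $\eta\in\omega^\omega$. A partial type $p(x)$ over $A$ is co-simple if no formula $\phi(z,y)\in L(A)$ has the tree property witnessed by some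 $(a_\eta)_{\eta\in\omega^{<\omega}}$ with each $a_\eta$ a tuple of realizations of $p$; here $(a_\eta)$ witnesses the tree property of $\phi$ if for some $k<\omega$ the set $\{\phi(z,a_{\eta\frown i})\}_{i<\omega}$ is $k$-inconsistent for every $\eta\in\omega^{<\omega}$ and $\{\phi(z,a_{\eta|i})\}_{i<\omega}$ is consistent for every $\eta\in\omega^\omega$. *)

(* Defs.v *)
From mathcomp Require Import all_boot.
From mathcomp Require Import boolp classical_sets functions cardinality.

Set Implicit Arguments.
Unset Strict Implicit.
Unset Printing Implicit Defensive.

Local Open Scope classical_set_scope.
Local Open Scope card_scope.

Record language := Language {
  lsort : Type;
  lfunc : Type;
  fdom : lfunc -> seq lsort;
  fcod : lfunc -> lsort;
  lrel : Type;
  rdom : lrel -> seq lsort }.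

(* A context is a family of sorted variables, of any cardinality; parameters
   from a model are treated as extra variables (see [params] below). *)
Record ctx (L : language) := Ctx { var :> Type; srt : var -> lsort L }.

Section Contexts.
Variable L : language.
Implicit Types c d : ctx L.

Definition vars (s : seq (lsort L)) : ctx L :=
  Ctx (fun i : 'I_(size s) => tnth (in_tuple s) i).

Definition catc c d : ctx L :=
  Ctx (fun i : c + d => match i with inl j => srt j | inr j => srt j end).

Definition powc (n : nat) c : ctx L := Ctx (fun i : 'I_n * c => srt i.2).

Definition extc c (s : lsort L) : ctx L :=
  Ctx (fun i : option c => if i is Some j then srt j else s).

Inductive term c : lsort L -> Type :=
  | Var (v : c) : term c (srt v)
  | App (f : lfunc L) (args : forall i : vars (fdom f), term c (srt i)) :
      term c (fcod f).

Inductive formula c : Type :=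
  | Eq (s : lsort L) (t u : term c s)
  | Rel (r : lrel L) (args : forall i : vars (rdom r), term c (srt i))
  | Bot
  | Imp (phi psi : formula c)
  | All (s : lsort L) (phi : formula (extc c s)).

Definition sentence := formula (vars [::]).

End Contexts.

Notation "c +++ d" := (catc c d) (at level 50, left associativity).

(* [elts D c]: the tuples of elements of D, of the sorts prescribed by c. *)
Definition elts (L : language) (D : lsort L -> Type) (c : ctx L) :=
  forall i : c, D (srt i).

Record structure (L : language) := Structure {
  dom :> lsort L -> Type;
  dom_inhabited : forall s, inhabited (dom s);
  funI : forall f : lfunc L, elts dom (vars (fdom f)) -> dom (fcod f);
  relI : forall r : lrel L, elts dom (vars (rdom r)) -> Prop }.

Section Semantics.
Variables (L : language) (M : structure L).
Implicit Types c d : ctx L.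

Definition cate c d (a : elts M c) (b : elts M d) : elts M (c +++ d) :=
  fun i => match i with inl j => a j | inr j => b j end.

Definition exte c (s : lsort L) (a : elts M c) (e : M s) : elts M (extc c s) :=
  fun i => match i with Some j => a j | None => e end.

Fixpoint eval c (a : elts M c) (s : lsort L) (t : term c s) : M s :=
  match t with
  | Var v => a v
  | App f args => funI (fun i => eval a (args i))
  end.

Fixpoint sat c (a : elts M c) (phi : formula c) : Prop :=
  match phi with
  | Eq s t u => eval a t = eval a u
  | Rel r args => relI (fun i => eval a (args i))
  | Bot => False
  | Imp phi psi => sat a phi -> sat a psi
  | All s phi => forall e : M s, sat (exte a e) phi
  end.

Definition true_in (sigma : sentence L) : Prop :=
  forall a : elts M (vars [::]), sat a sigma.

Definition element := {s : lsort L & M s}.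

(* The context of the names of the elements of B: formulas of L(B) in the
   variables c are formulas in the context [c +++ params B]. *)
Definition params (B : set element) : ctx L :=
  Ctx (fun e : {e : element | B e} => projT1 (sval e)).

Definition names (B : set element) : elts M (params B) :=
  fun e => projT2 (sval e).

Definition solutions c d (phi : formula (c +++ d)) (b : elts M d) :
  set (elts M c) := [set a | sat (cate a b) phi].

(* Formulas with parameters in M are identified with the sets they define; a
   set of them is consistent when it is finitely satisfiable in M. *)
Definition consistent c (F : set (set (elts M c))) : Prop :=
  forall G, finite_set G -> G `<=` F -> \bigcap_(X in G) X !=set0.

(* Inconsistency of k-element subfamilies, counted by index: equal members
   with distinct indices count as distinct. *)
Definition k_inconsistent (k : nat) c (X : nat -> set (elts M c)) : Prop :=
  forall s : seq nat, uniq s -> size s = k ->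
    ~ consistent [set X i | i in [set` s]].

End Semantics.

Arguments names {L M B}.

Definition theory (L : language) := set (sentence L).

Definition model (L : language) (T : theory L) (M : structure L) : Prop :=
  forall sigma, T sigma -> true_in M sigma.

Definition entails (L : language) (T : theory L) (sigma : sentence L) : Prop :=
  forall M : structure L, model T M -> true_in M sigma.

Definition complete (L : language) (T : theory L) : Prop :=
  (exists M : structure L, model T M) /\
  forall sigma, entails T sigma \/ entails T (Imp sigma (Bot _)).

(* |B| < kappa, where the cardinal kappa is given as that of a type K. *)
Definition card_lt (U : Type) (B : set U) (K : Type) : Prop :=
  (B #<= [set: K]) /\ ~ ([set: K] #<= B).

Section Monster.
Variables (L : language) (M : structure L) (K : Type).

Definition saturated : Prop :=
  forall (B : set (element M)) (x : seq (lsort L))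
         (q : set (formula (vars x +++ params B))),
    card_lt B K ->
    consistent [set solutions phi names | phi in q] ->
    \bigcap_(phi in q) solutions phi names !=set0.

Definition automorphism (g : forall s, M s -> M s) : Prop :=
  [/\ forall s, bijective (g s),
      forall (f : lfunc L) (a : elts M (vars (fdom f))),
        g _ (funI a) = funI (fun i => g _ (a i))
    & forall (r : lrel L) (a : elts M (vars (rdom r))),
        relI a <-> relI (fun i => g _ (a i))].

Definition strongly_homogeneous : Prop :=
  forall (c : ctx L) (a b : elts M c),
    card_lt [set: c] K ->
    (forall phi : formula c, sat a phi <-> sat b phi) ->
    exists2 g, automorphism g & forall i, g _ (a i) = b i.

(* M is a monster model with respect to the cardinal kappa = |K| > |T|; "small"
   means of cardinality less than kappa. *)
Definition monster : Prop :=
  [/\ card_lt [set: nat] K,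
      [/\ card_lt [set: lsort L] K, card_lt [set: lfunc L] K
        & card_lt [set: lrel L] K],
      saturated
    & strongly_homogeneous].

End Monster.

Section Properties.
Variables (L : language) (M : structure L).

Definition TP2 (x y : seq (lsort L)) (phi : formula (vars x +++ vars y)) : Prop :=
  exists a : nat -> nat -> elts M (vars y),
    (forall alpha, k_inconsistent 2 (fun i => solutions phi (a alpha i))) /\
    (forall f : nat -> nat,
      consistent (range (fun alpha => solutions phi (a alpha (f alpha))))).

Definition NTP2 : Prop :=
  forall (x y : seq (lsort L)) (phi : formula (vars x +++ vars y)), ~ TP2 phi.

(* Nodes of the tree omega^{<omega} are finite sequences of naturals: eta^i is
   [rcons eta i] and f|i is [mkseq f i]. *)
Definition tree_pattern c (X : seq nat -> set (elts M c))
    (q : set (set (elts M c))) : Prop :=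
  (exists k, forall eta, k_inconsistent k (fun i => X (rcons eta i))) /\
  (forall f : nat -> nat, consistent (range (fun i => X (mkseq f i)) `|` q)).

Variables (A : set (element M)) (x : seq (lsort L)).
Variable p : set (formula (vars x +++ params A)).

Definition sets_of : set (set (elts M (vars x))) :=
  [set solutions phi names | phi in p].

Definition partial_type : Prop := consistent sets_of.

Definition realizations : set (elts M (vars x)) := \bigcap_(X in sets_of) X.

(* p(M)^n, as a set of tuples in the n-fold power of the variables x. *)
Definition realizations_pow (n : nat) : set (elts M (powc n (vars x))) :=
  [set a | forall i : 'I_n, realizations (fun j => a (i, j))].
Arguments realizations_pow n _ : clear implicits.

Definition stably_embedded : Prop :=
  forall (n : nat) (z : seq (lsort L))
         (phi : formula (powc n (vars x) +++ vars z)) (c : elts M (vars z)),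
  exists (m : nat)
         (psi : formula (powc n (vars x) +++ powc m (vars x) +++ params A))
         (d : elts M (powc m (vars x))),
    realizations_pow m d /\
    realizations_pow n `&` solutions phi c =
    realizations_pow n `&` [set a | sat (cate (cate a d) names) psi].

Definition simple : Prop :=
  ~ exists (y : seq (lsort L)) (phi : formula (vars x +++ vars y))
           (a : seq nat -> elts M (vars y)),
      tree_pattern (fun eta => solutions phi (a eta)) sets_of.

Definition co_simple : Prop :=
  ~ exists (z : seq (lsort L)) (m : nat)
           (phi : formula (vars z +++ powc m (vars x) +++ params A))
           (a : seq nat -> elts M (powc m (vars x))),
      (forall eta, realizations_pow m (a eta)) /\
      tree_pattern
        (fun eta => [set b | sat (cate (cate b (a eta)) names) phi])
        set0.

End Properties.

(* Main.v *)
Require Import Defs.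
From mathcomp Require Import all_boot.
From mathcomp Require Import boolp classical_sets functions cardinality.

(** Suppose that a formula [phi(x,y)] and a tree of parameters show that [p] is
    not simple. The idea is to replace the parameters by tuples of realizations of
    [p], using stable embeddedness; the new tree then contradicts co-simplicity.

    Stable embeddedness gives, for each node, some formula [psi(x,w)] over [A] and
    some tuple [d] in [p] such that [phi(x,a)] and [psi(x,d)] have the same
    solutions among the realizations of [p]. The difficulty is uniformity: [psi]
    may vary with the node, and the equality holds only on the realizations of
    [p], which need not form a definable set. At the root [a], saturation provides
    a finite conjunction [P] of formulas of [p] under which [phi(x,a)] and
    [psi(x,d)] are equivalent ([stably_embedded_formula]). The same [P] and [psi]
    serve the other nodes if they all have the type of the root over [A], which
    can be arranged by changing the tree ([tree_same_type]): an
    automorphism over [A] that carries the root to the node [a_eta]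
    ([conjugate]) carries [d] to a tuple [d_eta] in [p] for which the same
    equivalence holds, with the same [P] and [psi]. Then [P(x) /\ psi(x,w)] with
    the tuples [d_eta] has the tree property: its instances imply those of [phi],
    and along a branch the instances of [phi] are consistent with [P].

    A tree whose nodes have the same type is found by compactness. For one
    formula, every tree has a subtree on whose nodes the formula is constantly
    true or constantly false ([monochromatic_subtree]), and passing to a subtree
    preserves the tree property. A set of formulas holds throughout some tree as
    soon as each finite part does ([tree_in_compact]), so by Zorn's lemma there is a
    maximal such set, and it is a complete type. The compactness step realizes a
    type in countably many variables, which reduces to saturation for finite
    tuples by choosing one coordinate after the other ([countable_saturation]).
    Working with definable sets instead of formulas keeps the syntax confined to
    the closure properties of [definable]. *)

Set Implicit Arguments.
Unset Strict Implicit.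
Unset Printing Implicit Defensive.

Local Open Scope classical_set_scope.
Local Open Scope card_scope.

(** * Finite sets and small sets *)

Lemma finite_set_ind (T : Type) (P : set T -> Prop) :
  P set0 -> (forall x E, P E -> P (x |` E)) -> forall F, finite_set F -> P F.
Proof.
elim/Pchoice: T => T in P *.
move=> P0 PU F /finite_seqP[s ->]; elim: s => [|x s IHs].
  by have -> : [set` [::]] = set0 :> set T by apply/seteqP; split.
have -> : [set` x :: s] = x |` [set` s]; last exact: PU.
apply/seteqP; split=> y /=; rewrite inE.
  by move=> /orP[/eqP|]; [left|right].
by move=> [->|->]; rewrite ?eqxx ?orbT.
Qed.

Lemma finite_set_bounded (T : Type) (f : T -> nat) (V : set T) :
  finite_set V -> exists m, forall i, V i -> f i < m.
Proof.
move: V; apply: finite_set_ind => [|i V [m Vm]]; first by exists 0.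
exists (maxn (f i).+1 m) => j [->|/Vm]; rewrite leq_max ?leqnn //.
by move=> ->; rewrite orbT.
Qed.

Lemma finite_subset_image (T U : Type) (f : T -> U) (D : set T) (G : set U) :
  finite_set G -> G `<=` f @` D ->
  exists D', [/\ finite_set D', D' `<=` D & G = f @` D'].
Proof.
move=> finG; move: G finG; apply: finite_set_ind => [_|y E IH sub].
  by exists set0; split; rewrite ?image_set0 //; apply: finite_set0.
have [|D' [finD' subD' ->]] := IH; first by move=> z Ez; apply: sub; right.
have [|x Dx fx] := sub y; first by left.
exists (x |` D'); split.
- by rewrite finite_setU; split=> //; apply: finite_set1.
- by move=> z [->|/subD'].
- by rewrite image_setU image_set1 fx.
Qed.

Lemma card_leTP (T U : Type) :
  [set: T] #<= [set: U] <-> exists f : T -> U, injective f.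
Proof.
split=> [/card_leP[f]|[f injf]].
  exists (fun x => sval (f (exist _ x (mem_set I)))) => x y exy.
  suff: f (exist _ x (mem_set I)) = f (exist _ y (mem_set I)).
    by move=> /(@inj _ _ _ f); rewrite !in_setT => /(_ isT isT) [].
  exact: val_inj.
have -> : [set: T] = f @^-1` [set: U] by apply/seteqP; split.
by apply: card_ge_preimage => x y _ _; apply: injf.
Qed.

Lemma card_eq_sig (T : Type) (B : set T) : [set: {x | B x}] #= B.
Proof.
have imE : sval @` [set: {x | B x}] = B.
  by apply/seteqP; split=> [_ [[x Bx] _ <-]|x Bx] //; exists (exist _ x Bx).
apply/card_esym; rewrite -[X in X #= _]imE; apply: inj_card_eq.
by move=> [x Bx] [y By] _ _ /= exy; subst y; congr exist.
Qed.

Lemma card_lt_le (T U K : Type) (A : set T) (B : set U) :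
  A #<= B -> card_lt B K -> card_lt A K.
Proof.
move=> AB [BK KB]; split; first exact: card_le_trans AB BK.
by move=> KA; apply: KB; apply: card_le_trans KA AB.
Qed.

(** An infinite set loses nothing by dropping a point: an injection of [K] into
    [option U] can be moved off [None] by the shift of Hilbert's hotel. *)
Lemma card_lt_option (U K : Type) :
  card_lt [set: nat] K -> card_lt [set: U] K -> card_lt [set: option U] K.
Proof.
move=> [/card_leTP[h injh] _] [/card_leTP[f injf] KU]; split.
  have [k0 k0f] : exists k0, forall u, f u <> k0.
    apply: contrapT => /forallNP H; apply: KU; apply/card_leTP.
    have /choice[g gP] : forall k, exists u, f u = k.
      by move=> k; apply: contrapT => /forallNP Hk; apply: (H k).
    by exists g => k k' e; rewrite -(gP k) e gP.
  apply/card_leTP; exists (fun o => if o is Some u then f u else k0).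
  move=> [u|] [v|] //= => [/injf ->//|/k0f //|e].
  by have := k0f v; rewrite e.
move=> /card_leTP[g injg]; apply: KU; apply/card_leTP.
suff [s injs sN] : exists2 s : K -> K, injective s & forall k, g (s k) <> None.
  have /choice[r rP] : forall k, exists u, g (s k) = Some u.
    by move=> k; have := sN k; case: (g (s k)) => // u _; exists u.
  by exists r => k k' e; apply: injs; apply: injg; rewrite !rP e.
have [[k0 gk0]|nN] := pselect (exists k0, g k0 = None); last first.
  by exists id => // k gk; apply: nN; exists k.
have [s injs sh0] : exists2 s : K -> K, injective s & forall k, s k <> h 0.
  have /choice[s sP] : forall k, exists k',
      (exists2 n, k = h n & k' = h n.+1) \/ ((forall n, k <> h n) /\ k' = k).
    move=> k; have [[n e]|nh] := pselect (exists n, k = h n).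
      by exists (h n.+1); left; exists n.
    by exists k; right; split=> // n e; apply: nh; exists n.
  exists s => [k k'|k].
    case: (sP k) => [[n -> ->]|[nk ->]]; case: (sP k') => [[n' -> ->]|[nk' ->]] //.
    - by move=> /injh[->].
    - by move=> e; case: (nk' n.+1).
    - by move=> e; case: (nk n'.+1).
  by case: (sP k) => [[n _ ->] /injh|[nk ->]] //; apply: nk.
(* The transposition of h 0 and k0. *)
have /choice[t tP] : forall k, exists k',
    [\/ k = k0 /\ k' = h 0, [/\ k <> k0, k = h 0 & k' = k0]
      | [/\ k <> k0, k <> h 0 & k' = k]].
  move=> k; have [e|n1] := pselect (k = k0); first by exists (h 0); constructor 1.
  have [e|n2] := pselect (k = h 0); first by exists k0; constructor 2.
  by exists k; constructor 3.
exists (t \o s) => [k k' /= e|k /= gN].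
  apply: injs; move: e; case: (tP (s k)) => -[]; case: (tP (s k')) => -[] *;
    congruence.
have {gN} : t (s k) = k0 by apply: injg; rewrite gN gk0.
by have := sh0 k; case: (tP (s k)) => -[] *; congruence.
Qed.

Lemma card_lt_ord_sum (n : nat) (U K : Type) :
  card_lt [set: nat] K -> card_lt [set: U] K -> card_lt [set: 'I_n + U] K.
Proof.
move=> Kinf; elim: n => [|n IHn] smallU.
  apply: card_lt_le smallU; apply/card_leTP.
  exists (fun x : 'I_0 + U => match x with
    | inl i => False_rect _ (notF (ltn_ord i))
    | inr u => u end).
  by move=> [[]|u] // [[]|v] // ->.
apply: card_lt_le (card_lt_option Kinf (IHn smallU)); apply/card_leTP.
exists (fun x => match x with
  | inl i => if unlift ord0 i is Some j then Some (inl j) else None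
  | inr u => Some (inr u) end).
move=> [i|u] [j|v] //=; last by move=> [->].
- by case: unliftP => [?|] -> //; case: unliftP => [?|] -> //; case=> ->.
- by case: unliftP.
- by case: unliftP.
Qed.

Lemma card_lt_setU1 (T K : Type) (A : set T) (x : T) :
  card_lt [set: nat] K -> card_lt A K -> card_lt (A `|` [set x]) K.
Proof.
move=> Kinf smallA.
have smallA' : card_lt [set: {y | A y}] K.
  by apply: card_lt_le smallA; rewrite (card_le_eql (card_eq_sig A)).
apply: card_lt_le (card_lt_option Kinf smallA').
rewrite -(card_le_eql (card_eq_sig _)); apply/card_leTP.
have /choice[f fP] : forall y : {y | (A `|` [set x]) y},
    exists o : option {y | A y}, sval y = if o is Some z then sval z else x.
  by move=> [y [Ay|yx]]; [exists (Some (exist _ y Ay))|exists None].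
exists f => -[y By] [z Bz] e; have := fP (exist _ z Bz); rewrite -e -fP /= => eyz.
by subst z; congr exist.
Qed.

Lemma card_lt_setU_finite (T K : Type) (A F : set T) :
  card_lt [set: nat] K -> card_lt A K -> finite_set F -> card_lt (A `|` F) K.
Proof.
move=> Kinf smallA finF; move: F finF.
apply: finite_set_ind => [|x E smallE]; first by rewrite setU0.
by rewrite setUCA setUC; apply: card_lt_setU1.
Qed.

(** * Substitution and finite support *)

(** Changing the value of one variable. The values live in types that depend on
    the variable, so the new one is transported along [j = i]; elements and terms
    are updated alike, and [update_map] relates the two through evaluation. *)
Definition update (I : Type) (P : I -> Type) (a : forall i, P i) (j : I) (e : P j)
    (i : I) : P i :=
  match pselect (j = i) with
  | left ji => eq_rect j P e i ji
  | right _ => a i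
  end.

Lemma update_same (I : Type) (P : I -> Type) (a : forall i, P i) (j : I) (e : P j) :
  update a e j = e.
Proof.
by rewrite /update; case: pselect => // jj; rewrite (Prop_irrelevance jj erefl).
Qed.

Lemma update_other (I : Type) (P : I -> Type) (a : forall i, P i) (j : I) (e : P j)
    (i : I) : j <> i -> update a e i = a i.
Proof. by rewrite /update; case: pselect. Qed.

Lemma update_map (I : Type) (P Q : I -> Type) (h : forall i, P i -> Q i)
    (a : forall i, P i) (j : I) (e : P j) (i : I) :
  h i (update a e i) = update (fun i => h i (a i)) (h j e) i.
Proof. by rewrite /update; case: pselect => // ji; case: i / ji. Qed.

Section Substitution.
Variable L : language.
Implicit Types c d : ctx L.

Fixpoint term_subst c d (sigma : forall i : c, term d (srt i)) s (t : term c s) :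
    term d s :=
  match t in term _ s return term d s with
  | Var v => sigma v
  | App f args => App (fun i => term_subst sigma (args i))
  end.

Definition lift_subst c d (sigma : forall i : c, term d (srt i)) s
    (i : extc c s) : term (extc d s) (srt i) :=
  match i return term (extc d s) (srt (c := extc c s) i) with
  | Some j => term_subst (fun v : d => Var (Some v : extc d s)) (sigma j)
  | None => Var (None : extc d s)
  end.

Fixpoint formula_subst c d (sigma : forall i : c, term d (srt i))
    (phi : formula c) : formula d :=
  match phi with
  | Eq s t u => Eq (term_subst sigma t) (term_subst sigma u)
  | Rel r args => Rel (fun i => term_subst sigma (args i))
  | Bot => Bot d
  | Imp phi psi => Imp (formula_subst sigma phi) (formula_subst sigma psi)
  | All s phi => All (formula_subst (lift_subst sigma (s := s)) phi)
  end.

Variable M : structure L.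

Lemma eval_subst c d (sigma : forall i : c, term d (srt i)) (b : elts M d)
    s (t : term c s) :
  eval b (term_subst sigma t) = eval (fun i => eval b (sigma i)) t.
Proof.
by elim: t => //= f args IH; apply: congr1; apply: functional_extensionality_dep => i.
Qed.

Lemma eval_lift c d (sigma : forall i : c, term d (srt i)) (b : elts M d)
    s (e : M s) :
  (fun i => eval (exte b e) (lift_subst sigma i)) =
  exte (fun i => eval b (sigma i)) e.
Proof. by apply: functional_extensionality_dep => -[i|] //=; rewrite eval_subst. Qed.

Lemma sat_subst c d (sigma : forall i : c, term d (srt i)) (b : elts M d)
    (phi : formula c) :
  sat b (formula_subst sigma phi) <-> sat (fun i => eval b (sigma i)) phi.
Proof.
elim: phi d sigma b =>
  {c} [c s t u|c r args|c|c phi IHphi psi IHpsi|c s phi IH] d sigma b /=.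
- by rewrite !eval_subst.
- have -> // : (fun i => eval b (term_subst sigma (args i))) =
               (fun i => eval (fun j => eval b (sigma j)) (args i)).
  by apply: functional_extensionality_dep => i; rewrite eval_subst.
- by [].
- by rewrite IHphi IHpsi.
- by split=> H e; have := H e; rewrite IH eval_lift.
Qed.

Lemma term_support c s (t : term c s) :
  exists2 V : set c, finite_set V &
    forall a b : elts M c, (forall i, V i -> a i = b i) -> eval a t = eval b t.
Proof.
elim: t => [v|f args IH].
  exists [set v] => [|a b ab]; [exact: finite_set1|exact: ab].
have /choice[V VP] : forall i, exists V : set c, finite_set V /\
    forall a b : elts M c, (forall i, V i -> a i = b i) ->
      eval a (args i) = eval b (args i).
  by move=> i; have [V] := IH i; exists V.
exists (\bigcup_(i in [set: 'I_(size (fdom f))]) V i).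
  apply: bigcup_finite => [|i _]; last by case: (VP i).
  exact: finite_finset.
move=> a b ab /=; apply: congr1; apply: functional_extensionality_dep => i.
by apply: (VP i).2 => j Vj; apply: ab; exists i.
Qed.

Lemma formula_support c (phi : formula c) :
  exists2 V : set c, finite_set V &
    forall a b : elts M c, (forall i, V i -> a i = b i) -> sat a phi <-> sat b phi.
Proof.
elim: phi =>
  {c} [c s t u|c r args|c|c phi [V finV IHV] psi [W finW IHW]|c s phi [V finV IH]].
- have [V finV Vt] := term_support t; have [W finW Wu] := term_support u.
  exists (V `|` W) => [|a b ab /=]; first by rewrite finite_setU.
  have -> : eval a t = eval b t by apply: Vt => i Vi; apply: ab; left.
  by have -> : eval a u = eval b u by apply: Wu => i Wi; apply: ab; right.
- have /choice[V VP] : forall i, exists V : set c, finite_set V /\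
      forall a b : elts M c, (forall i, V i -> a i = b i) ->
        eval a (args i) = eval b (args i).
    by move=> i; have [V] := term_support (args i); exists V.
  exists (\bigcup_(i in [set: 'I_(size (rdom r))]) V i).
    apply: bigcup_finite => [|i _]; last by case: (VP i).
    exact: finite_finset.
  move=> a b ab /=.
  have -> // : (fun i => eval a (args i)) = (fun i => eval b (args i)).
  apply: functional_extensionality_dep => i.
  by apply: (VP i).2 => j Vj; apply: ab; exists i.
- by exists set0 => //; apply: finite_set0.
- exists (V `|` W) => [|a b ab /=]; first by rewrite finite_setU.
  have abV : sat a phi <-> sat b phi by apply: IHV => i Vi; apply: ab; left.
  have abW : sat a psi <-> sat b psi by apply: IHW => i Wi; apply: ab; right.
  by rewrite abV abW.
- exists (Some @^-1` V) => [|a b ab /=].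
    by apply: finite_preimage => // i j _ _ [].
  have abe e : sat (exte a e) phi <-> sat (exte b e) phi.
    by apply: IH => -[i Vi|] //=; apply: ab.
  by split=> H e; apply/abe/H.
Qed.

End Substitution.

(** * Definable sets *)

Section Definability.
Variables (L : language) (M : structure L).
Implicit Types (c d : ctx L) (B : set (element M)).

Definition definable B c (X : set (elts M c)) : Prop :=
  exists phi : formula (c +++ params B), X = solutions phi names.

Definition from B c (a : elts M c) : Prop := forall i, B (existT _ (srt i) (a i)).

Definition assign c (a : elts M c) (j : c) (e : M (srt j)) : elts M c :=
  update (P := fun i : c => M (srt i)) a e.
Arguments assign [c] a j e.

Lemma assign_same c (a : elts M c) (j : c) (e : M (srt j)) : assign a j e j = e.
Proof. exact: (update_same (P := fun i : c => M (srt i))). Qed.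

Lemma assign_other c (a : elts M c) (j : c) (e : M (srt j)) (i : c) :
  j <> i -> assign a j e i = a i.
Proof. exact: (update_other (P := fun i : c => M (srt i))). Qed.

Lemma definableP B c (X : set (elts M c)) (phi : formula (c +++ params B)) :
  (forall a, X a <-> sat (cate a names) phi) -> definable B X.
Proof. by move=> H; exists phi; apply/seteqP; split=> a /H. Qed.

Lemma definable_ext B c (X Y : set (elts M c)) :
  (forall a, X a <-> Y a) -> definable B X -> definable B Y.
Proof. by move=> XY [phi XE]; apply: (definableP (phi := phi)) => a; rewrite -XY XE. Qed.

Lemma definable_preimage B B' c d (X : set (elts M d))
    (sigma : forall i : d, term (c +++ params B) (srt i)) :
  B' `<=` B -> definable B' X ->
  definable B [set a : elts M c | X (fun i => eval (cate a names) (sigma i))].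
Proof.
move=> B'B [phi ->].
pose tau (i : d +++ params B') : term (c +++ params B) (srt i) :=
  match i with
  | inl i => sigma i
  | inr (exist e B'e) =>
      Var (inr (exist _ e (B'B e B'e)) : c +++ params B)
  end.
apply: (definableP (phi := formula_subst tau phi)) => a; rewrite sat_subst.
have -> // : (fun i => eval (cate a names) (tau i)) =
             cate (fun i => eval (cate a names) (sigma i)) names.
by apply: functional_extensionality_dep => -[i|[e B'e]].
Qed.

Lemma definable_mono B B' c (X : set (elts M c)) :
  B' `<=` B -> definable B' X -> definable B X.
Proof.
by move=> /definable_preimage H /(H _ _ _ (fun i => Var (inl i : c +++ params B))).
Qed.

Lemma definable_imp B c (X Y : set (elts M c)) :
  definable B X -> definable B Y -> definable B [set a | X a -> Y a].
Proof. by move=> [phi ->] [psi ->]; exists (Imp phi psi). Qed.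

Lemma definable_set0 B c : definable B (@set0 (elts M c)).
Proof. by exists (Bot _). Qed.

Lemma definable_setC B c (X : set (elts M c)) :
  definable B X -> definable B (~` X).
Proof. by move=> /definable_imp; apply; apply: definable_set0. Qed.

Lemma definable_setT B c : definable B [set: elts M c].
Proof. by rewrite -setC0; apply/definable_setC/definable_set0. Qed.

Lemma definable_setI B c (X Y : set (elts M c)) :
  definable B X -> definable B Y -> definable B (X `&` Y).
Proof.
move=> defX defY.
apply: definable_ext (definable_setC (definable_imp defX (definable_setC defY))).
move=> a /=; split=> [H|[Xa Ya]]; last by move=> H; apply: H.
by split; apply: contrapT => N; apply: H.
Qed.

Lemma definable_bigcap B c (I : Type) (D : set I) (X : I -> set (elts M c)) :
  finite_set D -> (forall i, D i -> definable B (X i)) ->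
  definable B (\bigcap_(i in D) X i).
Proof.
move=> finD; move: D finD; apply: finite_set_ind => [_|i D IH defX].
  by rewrite bigcap_set0; apply: definable_setT.
rewrite bigcap_setU1; apply: definable_setI; first by apply: defX; left.
by apply: IH => j Dj; apply: defX; right.
Qed.

Lemma definable_exists_var B c (j : c) (X : set (elts M c)) :
  definable B X -> definable B [set a | exists e : M (srt j), X (assign a j e)].
Proof.
move=> /definable_setC[phi XE].
pose D := extc (c +++ params B) (srt j).
pose tau (i : c +++ params B) : term D (srt i) :=
  match i with
  | inl i => update (P := fun i => term D (srt i))
               (fun i => Var (Some (inl i) : D)) (j := j) (Var (None : D)) i
  | inr e => Var (Some (inr e) : D)
  end.
suff defall : definable B [set a | forall e : M (srt j), ~ X (assign a j e)].
  apply: definable_ext (definable_setC defall) => a /=.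
  by split=> [/existsNP[e /contrapT]|[e Xe] /(_ e)//]; exists e.
apply: (definableP (phi := All (formula_subst tau phi))) => a /=.
have tauE e : (fun i => eval (exte (cate a names) e) (tau i)) =
              cate (assign a j e) names.
  apply: functional_extensionality_dep => -[i|i] //=.
  by rewrite (update_map (fun i : c => eval (exte (cate a names) e) (s := srt i))).
have XCE e : (~ X (assign a j e)) <-> sat (cate (assign a j e) names) phi.
  by have /(congr1 (fun Y => Y (assign a j e))) /= := XE; rewrite /setC /= => ->.
by split=> H e; have := H e; rewrite sat_subst tauE XCE.
Qed.

(** Quantifying the variables of [V] without leaving the context [c]: this also
    makes sense when [c] is infinite, as in the approximations below. *)
Lemma definable_exists_on B c (V : set c) (X : set (elts M c)) :
  finite_set V -> definable B X ->
  definable B [set a | exists2 a', X a' & forall i, ~ V i -> a' i = a i].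
Proof.
move=> finV; move: V finV; apply: finite_set_ind => [|j V IH] defX.
  apply: definable_ext defX => a; split=> [Xa|[a' Xa' a'a]]; first by exists a.
  suff <- : a' = a by [].
  by apply: functional_extensionality_dep => i; apply: a'a.
apply: definable_ext (definable_exists_var j (IH defX)) => a /=.
split=> [[e [a' Xa' a'a]]|[a' Xa' a'a]].
  exists a' => // i nVi; rewrite a'a => [|Vi]; last by apply: nVi; right.
  by apply: assign_other => ji; apply: nVi; left.
exists (a' j), a' => // i nVi.
have [<-|ji] := pselect (j = i); first by rewrite assign_same.
by rewrite assign_other // a'a // => -[/esym|].
Qed.

Lemma definable_section B B' c d (b0 : elts M d) (X : set (elts M (c +++ d))) :
  B' `<=` B -> from B b0 -> definable B' X ->
  definable B [set a | X (cate a b0)].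
Proof.
move=> B'B Bb0 defX.
pose sigma (i : c +++ d) : term (c +++ params B) (srt i) :=
  match i with
  | inl i => Var (inl i : c +++ params B)
  | inr j => Var (inr (exist _ _ (Bb0 j)) : c +++ params B)
  end.
apply: definable_ext (definable_preimage sigma B'B defX) => a /=.
suff -> : (fun i => eval (cate a names) (sigma i)) = cate a b0 by [].
by apply: functional_extensionality_dep => -[].
Qed.

(** Quantified variables are eliminated by the names of [b0]: the language may
    have no closed term of the required sorts. *)
Lemma definable_projection B c d (b0 : elts M d) (X : set (elts M (c +++ d))) :
  finite_set [set: d] -> from B b0 -> definable B X ->
  definable B [set a | exists b, X (cate a b)].
Proof.
move=> find Bb0 defX.
have finV : finite_set [set i : c +++ d | exists j, i = inr j].
  apply: sub_finite_set (finite_image (inr : d -> c +++ d) find) => _ [j ->].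
  by exists j.
have := definable_section (@subset_refl _ B) Bb0 (definable_exists_on finV defX).
apply: definable_ext => a /=.
split=> [[u Xu uE]|[b Xb]].
  exists (fun j => u (inr j)).
  suff <- : u = cate a (fun j => u (inr j)) by [].
  by apply: functional_extensionality_dep => -[i|j] //=; rewrite uE //; case.
by exists (cate a b) => // -[i|j] //= []; exists j.
Qed.

(** This turns a condition on a point of an infinite context, all of whose
    coordinates but one are named, into a condition to be met by saturation. *)
Lemma definable_fiber B c (a : elts M c) (j : c) (X : set (elts M c)) :
  from B a -> definable B X ->
  definable B [set e : elts M (vars [:: srt j]) |
    X (assign a j (e ord0))].
Proof.
move=> Ba defX; pose D := vars [:: srt j] +++ params B.
pose sigma := update (P := fun i : c => term D (srt i))
  (fun i => Var (inr (exist _ _ (Ba i)) : D)) (j := j) (Var (inl ord0 : D)).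
apply: definable_ext (definable_preimage sigma (@subset_refl _ B) defX) => e /=.
suff -> : (fun i => eval (cate e names) (sigma i)) = assign a j (e ord0) by [].
apply: functional_extensionality_dep => i.
by rewrite /sigma (update_map (fun i : c => eval (cate e names) (s := srt i))).
Qed.

Lemma definable_support B c (X : set (elts M c)) : definable B X ->
  exists2 V : set c, finite_set V &
    forall a b, (forall i, V i -> a i = b i) -> X a <-> X b.
Proof.
move=> [phi ->]; have [V finV VP] := formula_support M phi.
exists (inl @^-1` V) => [|a b ab].
  by apply: finite_preimage => // i j _ _ [].
by apply: VP => -[i Vi|i Vi] //=; apply: ab.
Qed.

End Definability.

Arguments assign [L M c] a j e.

(** * Realizing types in countably many variables *)

Section Saturation.
Variables (L : language) (M : structure L).
Implicit Types (c d : ctx L) (B : set (element M)).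

Lemma consistent_directed c (F : set (set (elts M c))) :
  F !=set0 -> (forall X, F X -> X !=set0) ->
  (forall X Y, F X -> F Y -> exists2 Z, F Z & Z `<=` X `&` Y) ->
  consistent F.
Proof.
move=> [X0 FX0] F0 FI G finG GF.
suff [Z FZ ZG] : exists2 Z, F Z & Z `<=` \bigcap_(X in G) X.
  by have [a Za] := F0 Z FZ; exists a; apply: ZG.
move: G finG GF; apply: finite_set_ind => [_|X G IH GF].
  by exists X0 => //; rewrite bigcap_set0.
have [|Z FZ ZG] := IH; first by move=> Y GY; apply: GF; right.
have [|Z' FZ' Z'XZ] := FI X Z _ FZ; first by apply: GF; left.
exists Z' => // a /Z'XZ[Xa /ZG Ga] Y [->//|]; exact: Ga.
Qed.

Lemma consistent_sub c (F F' : set (set (elts M c))) :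
  F' `<=` F -> consistent F -> consistent F'.
Proof. by move=> F'F conF G finG GF'; apply: conF => // X /GF'/F'F. Qed.

Variable K : Type.
Hypotheses (Kinf : card_lt [set: nat] K) (Msat : saturated M K).

Lemma one_variable (s : lsort L) (e : M s) :
  exists u : elts M (vars [:: s]), u ord0 = e.
Proof.
exists (fun i : 'I_1 => eq_rect ord0 (fun i => M (srt (c := vars [:: s]) i)) e i
                          (esym (ord1 i))).
by rewrite (Prop_irrelevance (esym (ord1 ord0)) erefl).
Qed.

Lemma saturated_definable B (s : seq (lsort L)) (F : set (set (elts M (vars s)))) :
  card_lt B K -> (forall X, F X -> definable B X) -> consistent F ->
  \bigcap_(X in F) X !=set0.
Proof.
move=> smallB defF conF.
pose q : set (formula (vars s +++ params B)) := [set phi | F (solutions phi names)].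
have qF : [set solutions phi names | phi in q] = F.
  apply/seteqP; split=> [_ [phi ? <-] //|X FX].
  by have [phi XE] := defF X FX; exists phi; rewrite /q /= -XE.
have [|a qa] := Msat (q := q) smallB; first by rewrite qF.
exists a => X FX; have [phi XE] := defF X FX; rewrite XE.
by apply: qa; rewrite /q /= -XE.
Qed.

Section Countable.
Variables (c : ctx L) (rk : c -> nat) (B : set (element M)).
Variable F : set (set (elts M c)).
Hypotheses (rk_inj : injective rk) (smallB : card_lt B K).
Hypothesis defF : forall X, F X -> definable B X.

(** The induction hypothesis of the coordinatewise construction. All values of
    [a] are named by a small set [B'], so that the possible next coordinates are
    described by a type to which saturation applies. *)
Let approx (m : nat) (a : elts M c) : Prop :=
  (exists B', [/\ card_lt B' K, B `<=` B' & from B' a]) /\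
  forall G, finite_set G -> G `<=` F ->
    exists2 b, (\bigcap_(X in G) X) b & forall i, rk i < m -> b i = a i.

(** A finite part of [F] constrains finitely many variables, so the later ones can
    be quantified away; what remains is a type of the [m]-th coordinate alone. *)
Lemma approx_extend (m : nat) (a : elts M c) : approx m a ->
  exists2 a', approx m.+1 a' & forall i, rk i < m -> a' i = a i.
Proof.
move=> [[B' [smallB' BB' B'a]] Ga].
have [[j jm]|noj] := pselect (exists j, rk j = m); last first.
  exists a => //; split=> [|G finG GF]; first by exists B'.
  have [b Gb ba] := Ga G finG GF; exists b => // i.
  by rewrite ltnS leq_eqVlt => /orP[/eqP im|/ba//]; case: noj; exists i.
pose E G : set (elts M (vars [:: srt j])) := [set e : elts M (vars [:: srt j]) |
  exists2 b, (\bigcap_(X in G) X) b &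
    forall i, rk i <= m -> b i = assign a j (e ord0) i].
pose FE := [set E G | G in [set G | finite_set G /\ G `<=` F]].
have defE X : FE X -> definable B' X.
  move=> [G [finG GF] <-].
  have defG : definable B' (\bigcap_(X in G) X).
    by apply: definable_bigcap => // Y /GF/defF; apply: definable_mono.
  have [V finV VG] := definable_support defG.
  pose W := V `&` [set i | m < rk i].
  have finW : finite_set W by apply: finite_setIl.
  apply: definable_ext (definable_fiber j B'a (definable_exists_on finW defG)).
  move=> e /=; split=> [[b Gb bE]|[b Gb bE]].
    by exists b => // i im; apply: bE => -[_ /=]; rewrite ltnNge im.
  exists (fun i => if pselect (W i) then b i else assign a j (e ord0) i).
    apply: (VG b _ _).1 Gb => i Vi; case: pselect => // nWi; apply: bE.
    by rewrite leqNgt; apply/negP => im; apply: nWi.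
  by move=> i nWi; case: pselect.
have conE : consistent FE.
  apply: consistent_directed.
  - exists (E set0), set0 => //; split; [exact: finite_set0|exact: sub0set].
  - move=> _ [G [finG GF] <-]; have [b Gb ba] := Ga G finG GF.
    have [e eb] := one_variable (b j); exists e, b => // i im; rewrite eb.
    have [<-|ji] := pselect (j = i); first by rewrite assign_same.
    rewrite assign_other // ba // ltn_neqAle im andbT -jm.
    by apply/eqP => /rk_inj/esym.
  - move=> _ _ [G [finG GF] <-] [G' [finG' GF'] <-].
    exists (E (G `|` G')).
      exists (G `|` G') => //; split; first by rewrite finite_setU.
      by move=> X [/GF|/GF'].
    by move=> e [b Gb be]; split; exists b => // X GX; apply: Gb; [left|right].
have [e FEe] := saturated_definable smallB' defE conE.
exists (assign a j (e ord0)); last first.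
  by move=> i im; apply: assign_other => ji; rewrite -ji jm ltnn in im.
split.
    exists (B' `|` [set existT _ (srt j) (e ord0)]); split.
    - exact: card_lt_setU1.
    - by move=> x /BB'; left.
    - move=> i; have [<-|ji] := pselect (j = i).
        by right; rewrite assign_same.
      by left; rewrite assign_other //; apply: B'a.
  move=> G finG GF; have [|b Gb be] := FEe (E G); first by exists G.
  by exists b => // i; rewrite ltnS; apply: be.
Qed.

(** Saturation realizes types of finite tuples; here the variables are realized
    one at a time along the enumeration [rk]. The point [a0] supplies a named
    value to every variable that has not been treated yet. *)
Lemma countable_saturation (a0 : elts M c) :
  from B a0 -> consistent F -> \bigcap_(X in F) X !=set0.
Proof.
move=> Ba0 conF.
have start : approx 0 a0.
  split=> [|G finG GF]; first by exists B; split=> // e.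
  by have [b Gb] := conF G finG GF; exists b.
have [step stepP] : exists step : nat -> elts M c -> elts M c, forall m a,
    approx m a ->
    approx m.+1 (step m a) /\ forall i, rk i < m -> step m a i = a i.
  have /choice[step stepP] : forall ma : nat * elts M c, exists a',
      approx ma.1 ma.2 ->
      approx ma.1.+1 a' /\ forall i, rk i < ma.1 -> a' i = ma.2 i.
    move=> [m a] /=; have [/approx_extend[a' ? ?]|?] := pselect (approx m a).
      by exists a'.
    by exists a.
  by exists (fun m a => step (m, a)) => m a; apply: stepP (m, a).
pose a := fix a m := if m is n.+1 then step n (a n) else a0.
have approx_a m : approx m (a m) by elim: m => //= m /stepP[].
have stable m n i : rk i < m -> m <= n -> a n i = a m i.
  move=> im; elim: n => [|n IH]; first by rewrite leqn0 => /eqP <-.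
  rewrite leq_eqVlt => /orP[/eqP<-//|]; rewrite ltnS => mn.
  rewrite -IH //=; apply: (stepP n _ (approx_a n)).2; exact: leq_trans mn.
exists (fun i => a (rk i).+1 i) => X FX.
have [V finV VX] := definable_support (defF FX).
have [m Vm] := finite_set_bounded rk finV.
have [_ /(_ [set X])[| |b Xb ba]] := approx_a m.
- exact: finite_set1.
- by move=> _ ->.
have {}Xb : X b by apply: Xb.
apply: (VX b _ _).1 Xb => i /Vm im; rewrite ba //; exact: stable.
Qed.

End Countable.
End Saturation.

(** * Monochromatic subtrees *)

(** Siblings stay siblings and branches stay on branches, but a level may be
    sent to sparser levels: the children of [h eta] sit above the extension
    [g eta] of [h eta]. *)
Definition tree_embedding (h : seq nat -> seq nat) : Prop :=
  exists (g : seq nat -> seq nat) (sigma : seq nat -> nat -> nat),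
    [/\ forall eta i, h (rcons eta i) = rcons (g eta) (sigma eta i),
        forall eta, injective (sigma eta)
      & forall eta, prefix (h eta) (g eta)].

(** The subtree is built from the root up: the children of a node are sent to
    children in [C] of a node above its image that has infinitely many of them. *)
Lemma rich_subtree (C : set (seq nat)) (rho : seq nat) :
  (forall nu, prefix rho nu ->
     exists2 mu, prefix nu mu & infinite_set [set i | C (rcons mu i)]) ->
  exists2 h, tree_embedding h & forall eta, C (h eta).
Proof.
move=> rich.
have /choice[g gP] : forall nu, exists mu, prefix rho nu ->
    prefix nu mu /\ infinite_set [set i | C (rcons mu i)].
  move=> nu; have [/rich[mu ? ?]|?] := pselect (prefix rho nu); first by exists mu.
  by exists nu.
have /choice[s sP] : forall mu, exists s : nat -> nat,
    infinite_set [set i | C (rcons mu i)] ->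
    injective s /\ forall i, C (rcons mu (s i)).
  move=> mu; have [inf|?] := pselect (infinite_set [set i | C (rcons mu i)]);
    last by exists id.
  have /infiniteP/pcard_leP[f] := inf; exists f => _; split=> [i j|i].
    by move=> /(@inj _ _ _ f); apply; rewrite in_setT.
  exact: (@funS _ _ _ _ f).
pose next nu i := rcons (g nu) (s (g nu) i).
pose h eta := foldl next (next rho 0) eta.
have hS eta i : h (rcons eta i) = next (h eta) i by rewrite /h -cats1 foldl_cat.
have rho_next nu i : prefix rho nu -> prefix rho (next nu i).
  move=> /[dup] rn /gP[ng _]; apply: prefix_trans rn _.
  exact: prefix_trans ng (prefix_rcons _ _).
have rho_h eta : prefix rho (h eta).
  elim/last_ind: eta => [|eta i IH]; rewrite ?hS; apply: rho_next => //.
  exact: prefix_refl.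
have C_next nu i : prefix rho nu -> C (next nu i) by move=> /gP[_ /sP[_]]; apply.
exists h.
  exists (g \o h), (s \o g \o h); split=> [eta i|eta|eta].
  - by rewrite hS.
  - by have [_ /sP[]] := gP _ (rho_h eta).
  - by have [] := gP _ (rho_h eta).
by elim/last_ind => [|eta i _]; rewrite ?hS; apply: C_next; rewrite ?prefix_refl.
Qed.

(** Unless the nodes with infinitely many children in [C] are cofinal above
    some node, there is a node above which almost all children of every node
    avoid [C]. *)
Lemma monochromatic_subtree (C : set (seq nat)) :
  exists2 h, tree_embedding h &
    (forall eta, C (h eta)) \/ (forall eta, ~ C (h eta)).
Proof.
have [[rho /rich_subtree[h ? ?]]|poor] := pselect (exists rho, forall nu,
    prefix rho nu ->
    exists2 mu, prefix nu mu & infinite_set [set i | C (rcons mu i)]).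
  by exists h => //; left.
have [rho rhoP] : exists rho, forall mu, prefix rho mu ->
    finite_set [set i | C (rcons mu i)].
  apply: contrapT => /forallNP H; apply: poor; exists [::] => nu _.
  by have /existsNP[mu /not_implyP[]] := H nu; exists mu.
have [|h ? ?] := @rich_subtree (~` C) rho; last by exists h => //; right.
move=> nu rn; exists nu; first exact: prefix_refl.
move=> finC; apply: infinite_nat.
have -> : [set: nat] = [set i | C (rcons nu i)] `|` [set i | (~` C) (rcons nu i)].
  by apply/seteqP; split=> // i _; apply: EM.
by rewrite finite_setU; split=> //; apply: rhoP.
Qed.

(** Finitely many nodes of the image of a branch lie on a common branch, which is
    all that the finite character of consistency asks for. *)
Lemma tree_embedding_path h (f : nat -> nat) n : tree_embedding h ->
  exists f', forall i, i < n -> exists j, h (mkseq f i) = mkseq f' j.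
Proof.
move=> [g [sigma [hS _ hg]]].
have prefix_path i j : i <= j -> prefix (h (mkseq f i)) (h (mkseq f j)).
  elim: j => [|j IH]; first by rewrite leqn0 => /eqP ->; apply: prefix_refl.
  rewrite leq_eqVlt => /orP[/eqP->|/IH]; first exact: prefix_refl.
  move=> /prefix_trans; apply; rewrite mkseqS hS.
  exact: prefix_trans (hg _) (prefix_rcons _ _).
exists (nth 0 (h (mkseq f n))) => i /ltnW/prefix_path/prefixP[t ->].
exists (size (h (mkseq f i))).
apply: (@eq_from_nth _ 0) => [|j ji]; first by rewrite size_mkseq.
by rewrite nth_mkseq // nth_cat ji.
Qed.

(** * Trees whose nodes have the same type *)

Section Trees.
Variables (L : language) (M : structure L).

Definition finite_meets c (q : set (set (elts M c))) : set (set (elts M c)) :=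
  [set \bigcap_(X in G) X | G in [set G | finite_set G /\ G `<=` q]].

Lemma consistent_finite_image c (I : Type) (D : set I) (U : I -> set (elts M c)) :
  finite_set D ->
  consistent [set U i | i in D] <-> exists b, forall i, D i -> U i b.
Proof.
move=> finD; split=> [conU|[b Db] G _ GU].
  have [b Ub] := conU _ (finite_image U finD) (fun X H => H).
  by exists b => i Di; apply: Ub; exists i.
by exists b => X /GU[i Di <-]; apply: Db.
Qed.

Lemma consistent_range c (U : nat -> set (elts M c)) (q : set (set (elts M c))) :
  consistent (range U `|` q) <->
  forall n P, finite_meets q P -> exists2 b, P b & forall i, i < n -> U i b.
Proof.
split=> [con n _ [G [finG Gq] <-]|H G finG GU].
  have [|X|b Gb] := con (G `|` U @` `I_n).
  - by rewrite finite_setU; split=> //; apply/finite_image/finite_II.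
  - by move=> [/Gq|[i _ <-]]; [right|left; exists i].
  by exists b => [X GX|i im]; apply: Gb; [left|right; exists i].
have [D [finD _ GD]] : exists D, [/\ finite_set D, D `<=` setT & G `\` q = U @` D].
  apply: finite_subset_image; first exact: finite_setD.
  by move=> X [/GU[]].
have [n Dn] := finite_set_bounded id finD.
have [|b qb Ub] := H n (\bigcap_(X in G `&` q) X).
  by exists (G `&` q) => //; split; [apply: finite_setIl|apply: subIsetr].
exists b => X GX; have [qX|nqX] := pselect (q X); first exact: qb.
have : (G `\` q) X by [].
by rewrite GD => -[i /Dn im <-]; apply: Ub.
Qed.

Variables (x y : seq (lsort L)) (phi : formula (vars x +++ vars y)).
Variables (k : nat) (q : set (set (elts M (vars x)))).

Definition tree_of (a : seq nat -> elts M (vars y)) : Prop :=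
  (forall eta, k_inconsistent k (fun i => solutions phi (a (rcons eta i)))) /\
  (forall f : nat -> nat,
     consistent (range (fun i => solutions phi (a (mkseq f i))) `|` q)).

Lemma tree_of_embedding a h : tree_of a -> tree_embedding h -> tree_of (a \o h).
Proof.
move=> [inc con] emb; split=> [eta s uniq_s size_s|f].
  have [g [sigma [hS injs _]]] := emb.
  have := inc (g eta) (map (sigma eta) s).
  rewrite map_inj_uniq // size_map => /(_ uniq_s size_s); apply: contra_not.
  apply: consistent_sub => _ [_ /mapP[i si ->] <-]; exists i => //=.
  by rewrite hS.
apply/consistent_range => n P qP.
have [f' ff'] := tree_embedding_path f n emb.
have /choice[j jP] : forall i, exists j, i < n -> h (mkseq f i) = mkseq f' j.
  move=> i; have [/ff'[j ?]|?] := pselect (i < n); first by exists j.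
  by exists 0.
have [m jm] : exists m, forall i, `I_n i -> j i < m.
  exact/finite_set_bounded/finite_II.
have [b Pb Ub] := (consistent_range _ _).1 (con f') m P qP.
by exists b => // i im; rewrite /= jP //; apply/Ub/jm.
Qed.

Variables (K : Type) (B : set (element M)).
Hypotheses (Kinf : card_lt [set: nat] K) (Msat : saturated M K).
Hypotheses (smallB : card_lt B K) (q_def : forall X, q X -> definable B X).
Variables (x0 : elts M (vars x)) (y0 : elts M (vars y)).
Hypotheses (Bx0 : from B x0) (By0 : from B y0).

(** A whole tree is a single point of the countable context [nodes], and being a
    tree for [phi] and [q] is a conjunction of definable conditions on it. *)
Let nodes : ctx L := Ctx (fun i : seq nat * vars y => srt i.2).
Let node (a : elts M nodes) (eta : seq nat) : elts M (vars y) :=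
  fun j => a (eta, j).

Let incompatible eta (s : seq nat) : set (elts M nodes) :=
  [set a | ~ exists b, forall i, i \in s -> solutions phi (node a (rcons eta i)) b].

Let compatible (f : nat -> nat) n (P : set (elts M (vars x))) : set (elts M nodes) :=
  [set a | exists b, P b /\ forall i, i < n -> solutions phi (node a (mkseq f i)) b].

Let tree_conditions : set (set (elts M nodes)) :=
  [set Z | (exists eta s, [/\ uniq s, size s = k & Z = incompatible eta s]) \/
           exists f n P, finite_meets q P /\ Z = compatible f n P].

Let tree_conditionsP a : tree_of (node a) <-> forall Z, tree_conditions Z -> Z a.
Proof.
split=> [[inc con] _ [[eta [s [us ks ->]]]|[f [n [P [qP ->]]]]]|H].
- move=> ex; apply: (inc eta s us ks).
  exact/(consistent_finite_image _ (finite_seq s)).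
- by have [b Pb Ub] := (consistent_range _ _).1 (con f) n P qP; exists b.
split=> [eta s us ks|f].
  move=> /consistent_finite_image[|b Ub]; first exact: finite_seq.
  by apply: (H (incompatible eta s)); [left; exists eta, s|exists b].
apply/consistent_range => n P qP.
by have [|b []] := H (compatible f n P); [right; exists f, n, P|exists b].
Qed.

Let definable_at (eta : seq nat) :
  definable B [set u : elts M (nodes +++ vars x) |
    solutions phi (node (fun i => u (inl i)) eta) (fun j => u (inr j))].
Proof.
pose D := nodes +++ vars x +++ params B.
pose tau (i : vars x +++ vars y) : term D (srt i) :=
  match i with
  | inl j => Var (inl (inr j) : D)
  | inr j => Var (inl (inl (eta, j)) : D)
  end.
apply: (definableP (phi := formula_subst tau phi)) => u; rewrite sat_subst.
have -> // : (fun i => eval (cate u names) (tau i)) =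
  cate (fun j => u (inr j)) (node (fun i => u (inl i)) eta).
by apply: functional_extensionality_dep => -[].
Qed.

Let definable_conditions Z : tree_conditions Z -> definable B Z.
Proof.
have finx : finite_set [set: vars x] by apply: finite_finset.
move=> [[eta [s [_ _ ->]]]|[f [n [P [[G [finG Gq] <-] ->]]]]].
  apply/definable_setC.
  have finS := finite_seq s.
  have := definable_projection finx Bx0
    (definable_bigcap finS (fun i _ => definable_at (rcons eta i))).
  by apply: definable_ext.
have defP : definable B [set u : elts M (nodes +++ vars x) |
    (\bigcap_(X in G) X) (fun j => u (inr j))].
  pose D := nodes +++ vars x +++ params B.
  have := definable_preimage (fun j : vars x => Var (inl (inr j) : D))
    (@subset_refl _ B)
    (definable_bigcap finG (fun X GX => q_def (Gq X GX))).
  exact: definable_ext.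
have := definable_projection finx Bx0 (definable_setI defP
  (definable_bigcap (finite_II n) (fun i _ => definable_at (mkseq f i)))).
by apply: definable_ext.
Qed.

Definition tree_in (Gamma : set (set (elts M (vars y)))) : Prop :=
  exists2 a, tree_of a & forall eta X, Gamma X -> X (a eta).

Lemma tree_in_compact (Gamma : set (set (elts M (vars y)))) :
  (forall X, Gamma X -> definable B X) ->
  (forall G, finite_set G -> G `<=` Gamma -> tree_in G) -> tree_in Gamma.
Proof.
move=> defG finT.
pose at_node (Xe : set (elts M (vars y)) * seq nat) : set (elts M nodes) :=
  [set a | Xe.1 (node a Xe.2)].
pose F := at_node @` [set Xe | Gamma Xe.1] `|` tree_conditions.
have defF Z : F Z -> definable B Z.
  move=> [[[X eta] /defG defX <-]|]; last exact: definable_conditions.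
  by have := definable_preimage
    (fun j : vars y => Var (inl (eta, j) : nodes +++ params B)) (@subset_refl _ B) defX.
have conF : consistent F.
  move=> G finG GF.
  have [D [finD DG GD]] : exists D, [/\ finite_set D, D `<=` [set Xe | Gamma Xe.1]
      & G `\` tree_conditions = at_node @` D].
    by apply: finite_subset_image; [apply: finite_setD|move=> Z [/GF[]]].
  have [||a Ta Da] := finT (fst @` D); first exact: finite_image.
    by move=> _ [Xe /DG ? <-].
  exists (fun i => a i.1 i.2) => Z GZ.
  have [cZ|ncZ] := pselect (tree_conditions Z).
    by move: Z cZ {GZ}; apply/tree_conditionsP.
  have : (G `\` tree_conditions) Z by [].
  by rewrite GD => -[Xe DXe <-]; apply: Da; exists Xe.
pose rk (i : nodes) : nat := pickle (i : seq nat * 'I_(size y)).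
have rk_inj : injective rk by apply: pcan_inj (@pickleK _).
have By : from B (fun i : nodes => y0 i.2) by move=> i; apply: By0.
have [a Fa] := countable_saturation Kinf Msat rk_inj smallB defF By conF.
exists (node a).
  by apply/tree_conditionsP => Z cZ; apply: Fa; right.
by move=> eta X GX; apply: (Fa (at_node (X, eta))); left; exists (X, eta).
Qed.

(** A set of formulas that is maximal among those satisfied throughout some
    tree is complete: a tree for it has a monochromatic subtree for any
    further formula. *)
Lemma tree_same_type : (exists a, tree_of a) ->
  exists2 a, tree_of a &
    forall Z, definable B Z -> forall eta, Z (a eta) <-> Z (a [::]).
Proof.
move=> [a0 Ta0].
pose Good Gamma := (forall X, Gamma X -> definable B X) /\ tree_in Gamma.
have [F FGood Ftot|Gamma [[defG [a Ta Ga]] Gmax]] := @Zorn_bigcup _ Good.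
  split=> [X [Gamma FG GX]|]; first exact: (FGood Gamma FG).1.
  apply: tree_in_compact => [X [Gamma FG GX]|G finG GF].
    exact: (FGood Gamma FG).1.
  suff [->|[Gamma /FGood[_ [a Ta Ga]] GGamma]] :
      G = set0 \/ exists2 Gamma, F Gamma & G `<=` Gamma.
  - by exists a0.
  - by exists a => // eta X /GGamma; apply: Ga.
  move: G finG GF; apply: finite_set_ind => [|X G IH GF]; first by left.
  have [|Gamma FG GX] := GF X; first by left.
  right; have [|->|[Gamma' FG' GG']] := IH; first by move=> Y GY; apply: GF; right.
    by exists Gamma => // Y [->|].
  have [GaG|GaG] := Ftot _ _ FG FG'.
    by exists Gamma' => // Y [->|/GG' //]; apply: GaG.
  by exists Gamma => // Y [->//|/GG'/GaG].
have complete_Gamma Z h : definable B Z -> tree_embedding h ->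
    (forall eta, Z (a (h eta))) -> Gamma Z.
  move=> defZ emb hZ; apply: contrapT => nGZ; apply: (Gmax (Z |` Gamma)).
    by split=> [X GX|/(_ Z)]; [right|move=> GZ; apply/nGZ/GZ; left].
  split=> [X [->//|/defG//]|]; exists (a \o h); first exact: tree_of_embedding.
  by move=> eta X [->|/Ga]; [apply: hZ|apply].
exists a => // Z defZ eta.
have [h emb [hZ|hnZ]] := monochromatic_subtree [set eta | Z (a eta)].
  by have GZ := complete_Gamma Z h defZ emb hZ; split=> _; apply: Ga.
have GZ := complete_Gamma (~` Z) h (definable_setC defZ) emb hnZ.
by split=> Za; have := Ga _ _ GZ; case/(_ _ Za).
Qed.

End Trees.

(** * Automorphisms *)

Section Automorphisms.
Variables (L : language) (M : structure L) (g : forall s, M s -> M s).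
Hypothesis g_aut : automorphism g.

Definition move_elts c (a : elts M c) : elts M c := fun i => g (a i).

Lemma eval_automorphism c (a : elts M c) s (t : term c s) :
  g (eval a t) = eval (move_elts a) t.
Proof.
have [_ gF _] := g_aut.
elim: t => //= f args IH; rewrite gF; apply: congr1.
by apply: functional_extensionality_dep => i; apply: IH.
Qed.

Lemma automorphism_surj s (e : M s) : exists e', g e' = e.
Proof. by have [/(_ s)[h _ gh] _ _] := g_aut; exists (h e). Qed.

Lemma automorphism_inj s : injective (g (s := s)).
Proof. by have [/(_ s)/bij_inj] := g_aut. Qed.

Lemma move_elts_surj c (b : elts M c) : exists a, move_elts a = b.
Proof.
exists (fun i => sval (cid (automorphism_surj (b i)))).
by apply: functional_extensionality_dep => i; rewrite /move_elts; case: cid.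
Qed.

Lemma sat_automorphism c (a : elts M c) (phi : formula c) :
  sat a phi <-> sat (move_elts a) phi.
Proof.
have [_ _ gR] := g_aut.
elim: phi a => {c} [c s t u|c r args|c|c phi IHphi psi IHpsi|c s phi IH] a /=.
- by rewrite -!eval_automorphism; split=> [->//|/automorphism_inj].
- rewrite gR.
  have -> // : (fun i => g (eval a (args i))) =
               (fun i => eval (move_elts a) (args i)).
  by apply: functional_extensionality_dep => i; rewrite eval_automorphism.
- by [].
- by rewrite IHphi IHpsi.
have move_exte e : move_elts (exte a e) = exte (move_elts a) (g e).
  by apply: functional_extensionality_dep => -[].
split=> H e; last by rewrite IH move_exte.
by have [e' <-] := automorphism_surj e; rewrite -move_exte -IH.
Qed.

Lemma definable_automorphism (B : set (element M)) c (X : set (elts M c)) :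
  (forall e, B e -> g (projT2 e) = projT2 e) -> definable B X ->
  forall a, X (move_elts a) <-> X a.
Proof.
move=> gB [phi ->] a; rewrite /solutions /= [X in _ <-> X]sat_automorphism.
suff -> : cate (move_elts a) names = move_elts (cate a (names (B := B))) by [].
apply: functional_extensionality_dep => -[i|[e Be]] //=.
by rewrite /move_elts /= /names /= gB.
Qed.

End Automorphisms.

Definition entries (L : language) (M : structure L) (c : ctx L) (a : elts M c) :
    set (element M) :=
  range (fun i => existT M (srt i) (a i)).

Lemma card_lt_entries (L : language) (M : structure L) (K : Type)
    (B : set (element M)) (c : ctx L) (a : elts M c) :
  card_lt [set: nat] K -> card_lt B K -> finite_set [set: c] ->
  card_lt (B `|` entries a) K.
Proof.
move=> Kinf smallB finc.
by apply: card_lt_setU_finite Kinf smallB _; apply: finite_image.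
Qed.

Lemma elts_inhabited (L : language) (M : structure L) (c : ctx L) :
  exists a : elts M c, True.
Proof.
have ex s : exists e : M s, True by have [e] := dom_inhabited M s; exists e.
by exists (fun i => sval (cid (ex (srt i)))).
Qed.

Section Conjugates.
Variables (L : language) (M : structure L) (K : Type) (B : set (element M)).
Hypotheses (Kinf : card_lt [set: nat] K) (Mhom : strongly_homogeneous M K).
Hypothesis smallB : card_lt B K.

Lemma conjugate (y : seq (lsort L)) (a b : elts M (vars y)) :
  (forall Z, definable B Z -> Z a <-> Z b) ->
  exists g : forall s, M s -> M s, [/\ automorphism g, move_elts g a = b
    & forall e, B e -> g _ (projT2 e) = projT2 e].
Proof.
move=> ab.
have smallD : card_lt [set: vars y +++ params B] K.
  apply: card_lt_ord_sum => //.
  by apply: card_lt_le smallB; rewrite (card_le_eql (card_eq_sig B)).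
have [|g g_aut gab] := Mhom (a := cate a names) (b := cate b names) smallD.
  by move=> phi; apply: (ab (solutions phi names)); exists phi.
exists g; split=> //.
  by apply: functional_extensionality_dep => i; apply: gab (inl i).
by move=> e Be; apply: gab (inr (exist _ e Be)).
Qed.

End Conjugates.

(** * Stable embeddedness and the theorem *)

Section StableEmbedding.
Variables (L : language) (M : structure L) (K : Type) (A : set (element M)).
Hypotheses (Kinf : card_lt [set: nat] K) (Msat : saturated M K).
Hypothesis smallA : card_lt A K.
Variables (x : seq (lsort L)) (p : set (formula (vars x +++ params A))).

Lemma sets_of_definable X : sets_of p X -> definable A X.
Proof. by move=> [phi _ <-]; exists phi. Qed.

Lemma finite_meets_definable P : finite_meets (sets_of p) P -> definable A P.
Proof.
by move=> [G [finG Gp] <-]; apply: definable_bigcap => // X /Gp/sets_of_definable.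
Qed.

(** Stable embeddedness speaks of the realizations of [p], which need not
    form a definable set; by saturation it already holds on a definable set that
    finitely many formulas of [p] cut out. *)
Lemma stably_embedded_formula (y : seq (lsort L)) (phi : formula (vars x +++ vars y))
    (c : elts M (vars y)) : stably_embedded p ->
  exists (m : nat) (S : set (elts M (vars x +++ powc m (vars x))))
      (d : elts M (powc m (vars x))) (P : set (elts M (vars x))),
    [/\ definable A S, realizations_pow p d, finite_meets (sets_of p) P
      & forall b, P b -> solutions phi c b <-> S (cate b d)].
Proof.
pose pow1 : ctx L := powc 1 (vars x).
pose tau1 (i : vars x +++ vars y) : term (pow1 +++ vars y) (srt i) :=
  match i with
  | inl j => Var (inl (ord0, j) : pow1 +++ vars y)
  | inr j => Var (inr j : pow1 +++ vars y)
  end.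
pose phi1 := formula_subst tau1 phi.
move=> /(_ 1 y phi1 c)[m [psi [d [pd phi_psi]]]].
pose S1 : set (elts M (pow1 +++ powc m (vars x))) := solutions psi names.
pose D := vars x +++ powc m (vars x) +++ params A.
pose S : set (elts M (vars x +++ powc m (vars x))) :=
  [set u | S1 (cate (fun i : pow1 => u (inl i.2)) (fun j => u (inr j)))].
have defS : definable A S.
  have defS1 : definable A S1 by exists psi.
  pose tau (i : pow1 +++ powc m (vars x)) : term D (srt i) :=
    match i with
    | inl i => Var (inl (inl i.2) : D)
    | inr j => Var (inl (inr j) : D)
    end.
  apply: definable_ext (definable_preimage tau (@subset_refl _ A) defS1) => u /=.
  rewrite /S /=; set v := (X in S1 X); set w := (X in _ <-> S1 X).
  suff -> : v = w by [].
  by apply: functional_extensionality_dep => -[].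
pose agree : set (elts M (vars x)) := [set b | solutions phi c b <-> S (cate b d)].
have p_agree b : realizations p b -> agree b.
  move=> pb; pose b1 : elts M pow1 := fun i => b i.2.
  have pb1 : realizations_pow p b1 by [].
  have phi1E : solutions phi1 c b1 <-> solutions phi c b.
    rewrite /solutions /= sat_subst; set v := (X in sat X phi).
    suff -> : v = cate b c by [].
    by apply: functional_extensionality_dep => -[].
  rewrite /agree /= -phi1E; split=> [H|H].
    have : (realizations_pow p (n := 1) `&` solutions phi1 c) b1 by [].
    by rewrite phi_psi => -[].
  by have [] : (realizations_pow p (n := 1) `&` solutions phi1 c) b1 by rewrite phi_psi.
pose B := A `|` entries c `|` entries d.
have fin_m : finite_set [set: powc m (vars x)] by apply: finite_finset.
have smallB : card_lt B K.
  by apply: card_lt_entries => //; apply: card_lt_entries => //; apply: finite_finset.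
have AB : A `<=` B by move=> e; left; left.
have Bc : from B c by move=> i; left; right; exists i.
have Bd : from B d by move=> i; right; exists i.
have def_agree : definable B agree.
  have def_phi : definable B (solutions phi c).
    have def0 : definable A [set u : elts M (vars x +++ vars y) | sat u phi].
      pose E := vars x +++ vars y +++ params A.
      apply: (definableP (phi := formula_subst (fun i => Var (inl i : E)) phi)) => u.
      by rewrite sat_subst.
    exact: definable_section AB Bc def0.
  have def_S := definable_section AB Bd defS.
  apply: definable_ext (definable_setI (definable_imp def_phi def_S)
    (definable_imp def_S def_phi)) => b /=.
  by split=> [[]|[]].
have ncon : ~ consistent (sets_of p `|` [set ~` agree]).
  move=> con.
  have [X [pX|->]|b pb] := saturated_definable Msat smallB _ con.
  - by apply: definable_mono AB _; apply: sets_of_definable.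
  - exact: definable_setC.
  have : agree b by apply: p_agree => X pX; apply: pb; left.
  by apply: (pb (~` agree)); right.
have [P pP P_agree] : exists2 P, finite_meets (sets_of p) P & P `<=` agree.
  apply: contrapT => nP; apply: ncon => G finG Gp.
  have pG : finite_meets (sets_of p) (\bigcap_(X in G `&` sets_of p) X).
    by exists (G `&` sets_of p) => //; split; [apply: finite_setIl|apply: subIsetr].
  apply: contrapT => G0; apply: nP; exists (\bigcap_(X in G `&` sets_of p) X) => // b Gb.
  apply: contrapT => nb; apply: G0; exists b => X GX.
  by case: (Gp X GX) => [pX|->//]; apply: Gb.
by exists m, S, d, P; split.
Qed.

End StableEmbedding.

Theorem proposition6p25 (L : language) (T : theory L) (T_complete : complete T)
  (K : Type) (M : structure L) (M_model : model T M) (M_monster : monster M K)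
  (T_NTP2 : NTP2 M)
  (A : set (element M)) (A_small : card_lt A K)
  (x : seq (lsort L)) (p : set (formula (vars x +++ params A)))
  (p_type : partial_type p)
  (p_co_simple : co_simple p) (p_stably_embedded : stably_embedded p) :
  simple p.
Proof.
move=> [y [phi [a0 [[k inc] con]]]]; apply: p_co_simple.
have [Kinf _ Msat Mhom] := M_monster.
have [x0 _] := elts_inhabited M (vars x).
have [y0 _] := elts_inhabited M (vars y).
(* The names of x0 and y0 allow quantifiers over the sorts of x and y to be
   eliminated over B. *)
pose B := A `|` entries x0 `|` entries y0.
have smallB : card_lt B K.
  by do 2! [apply: card_lt_entries => //; last exact: finite_finset].
have AB : A `<=` B by move=> e; left; left.
have Bx0 : from B x0 by move=> i; left; right; exists i.
have By0 : from B y0 by move=> i; right; exists i.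
have p_def X : sets_of p X -> definable B X.
  by move=> /sets_of_definable; apply: definable_mono.
have [|a [{}inc {}con] same_type] :=
  tree_same_type (phi := phi) (k := k) Kinf Msat smallB p_def Bx0 By0.
  by exists a0.
have [m [S [d [P [defS pd pP phiS]]]]] :=
  stably_embedded_formula Kinf Msat A_small phi (a [::]) p_stably_embedded.
have conj eta : exists g : forall s, M s -> M s,
    [/\ automorphism g, move_elts g (a [::]) = a eta
      & forall e, A e -> g _ (projT2 e) = projT2 e].
  have [Z defZ|g [g_aut ga gB]] := conjugate Kinf Mhom smallB (a := a [::]) (b := a eta).
    by rewrite same_type.
  by exists g; split=> // e /AB/gB.
pose g eta := sval (cid (conj eta)).
have gP eta : [/\ automorphism (g eta), move_elts (g eta) (a [::]) = a eta
    & forall e, A e -> g eta _ (projT2 e) = projT2 e] := svalP (cid (conj eta)).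
have defP := finite_meets_definable pP.
(* P and S are A-definable, so g eta transports the equivalence from the root. *)
have phiS_conj eta b :
    P b -> solutions phi (a eta) b <-> S (cate b (move_elts (g eta) d)).
  have [g_aut <- gA] := gP eta.
  have [b' <-] := move_elts_surj g_aut b.
  have move_cate c c' (u : elts M c) (v : elts M c') :
      cate (move_elts (g eta) u) (move_elts (g eta) v) = move_elts (g eta) (cate u v).
    by apply: functional_extensionality_dep => -[].
  rewrite (definable_automorphism g_aut gA defP) move_cate.
  rewrite (definable_automorphism g_aut gA defS) => /phiS <-.
  by rewrite /solutions /= move_cate -sat_automorphism.
(* theta contradicts co-simplicity, along the tree of the conjugates of d. *)
have [theta thetaE] : definable A [set u : elts M (vars x +++ powc m (vars x)) |
    P (fun i => u (inl i)) /\ S u].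
  apply: definable_setI defS.
  pose D := vars x +++ powc m (vars x) +++ params A.
  exact: (definable_preimage (fun i : vars x => Var (inl (inl i) : D))
    (@subset_refl _ A) defP).
have thetaP b eta :
    sat (cate (cate b (move_elts (g eta) d)) names) theta <->
    P b /\ solutions phi (a eta) b.
  have /(congr1 (fun X => X (cate b (move_elts (g eta) d)))) /= := thetaE.
  rewrite /solutions /= => <-.
  by split=> -[Pb] /(phiS_conj eta b Pb).
exists x, m, theta, (fun eta => move_elts (g eta) d); split.
  move=> eta i X pX; have [g_aut _ gA] := gP eta.
  apply/(definable_automorphism g_aut gA (sets_of_definable pX)); exact: pd.
split=> [|f].
  exists k => eta s us ks; have := inc eta s us ks; apply: contra_not.
  move=> /(consistent_finite_image _ (finite_seq s))[b bs].
  apply/(consistent_finite_image _ (finite_seq s)); exists b => i /bs.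
  by move=> /thetaP[].
apply/consistent_range => n Q [G [finG G0] <-].
have [b Pb phib] := (consistent_range _ _).1 (con f) n P pP.
exists b => [X /G0//|i im]; apply/thetaP; split=> //; exact: phib.
Qed.
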